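(* Let $a,b\in\mathbb{Z}_{>0}$ be relatively prime and let $p,q\in\mathbb{R}$. Then, as an identity of Laurent polynomials in the variables $u$ and $v$, \[ v(1-u)\,\mathrm{R}(v,u,p,bq-ap,a,b)+u(1-v)\,\mathrm{R}(u,v,q,ap-bq,b,a) = u^{\lceil p\rceil}v^{\lceil q\rceil}\left(1-u^bv^a\right)-u^cv^d(1-u)(1-v), \] where $c\in\mathbb{Z}$ is (uniquely) determined by the conditions $ac\equiv ap-bq \pmod b$ and $p\le c<p+b$, and $d:=\frac{ac+bq-ap}{b}$. If $ap-bq\notin\mathbb{Z}$, then the last term $-u^cv^d(1-u)(1-v)$ on the right-hand side is to be omitted.
   Context: For $a,b\in\mathbb{Z}_{>0}$, $s,t\in\mathbb{R}$, and variables $u,v$, the Rademacher--Carlitz polynomial is \[ \mathrm{R}(u,v,s,t,a,b):=\sum_{k=\lceil s\rceil}^{\lceil s\rceil+b-1}u^{\left\lfloor\frac{ka+t}{b}\right\rfloor}v^k . \] Exponents may be negative, so this is a Laurent polynomial in general. *)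

(* Defs.v *)
From HB Require Import structures.
From mathcomp Require Import all_boot all_order all_algebra.
From mathcomp Require Import finmap boolp reals.
From mathcomp Require Import monalg.

Set Implicit Arguments.
Unset Strict Implicit.
Unset Printing Implicit Defensive.

Import Order.TTheory GRing.Theory Num.Theory.

Local Open Scope fset_scope.
Local Open Scope ring_scope.

(* The ring K[u, u^-1, v, v^-1]: finitely supported functions from the exponent
   group Z^2 to K with the convolution product.  The product that [monalg] puts
   on [malg] is not usable here: its [monomType] exponents have no inverses.
   Hence the alias, which carries its own ring structure. *)
Definition laurent (K : comNzRingType) : Type := malg (int * int)%type K.

HB.instance Definition _ (K : comNzRingType) :=
  GRing.Zmodule.copy (laurent K) (malg (int * int)%type K).

Section LaurentRing.
Variable K : comNzRingType.
Implicit Types (f g : laurent K) (k l : (int * int)%type) (x y : K).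

Definition lterm x k : laurent K := mkmalgU k x.

Definition lone : laurent K := lterm 1 0.

Definition lmul f g : laurent K :=
  \sum_(k <- msupp f) \sum_(l <- msupp g) lterm (f@_k * g@_l) (k + l).

Lemma lterm0 k : lterm 0 k = 0.
Proof. exact: monalgU0. Qed.

Lemma ltermD x y k : lterm (x + y) k = lterm x k + lterm y k.
Proof. exact: monalgUD. Qed.

Lemma laurentE f : f = \sum_(k <- msupp f) lterm f@_k k.
Proof. exact: monalgE. Qed.

Lemma lmulEw (d1 d2 : {fset (int * int)%type}) f g :
    msupp f `<=` d1 -> msupp g `<=` d2 ->
  lmul f g = \sum_(k <- d1) \sum_(l <- d2) lterm (f@_k * g@_l) (k + l).
Proof.
move=> le_d1 le_d2; rewrite /lmul (big_fset_incl _ le_d1) /=.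
  apply: eq_bigr => k _; apply: big_fset_incl => // l _ /mcoeff_outdom ->.
  by rewrite mulr0 lterm0.
move=> k _ /mcoeff_outdom fk.
by rewrite big1 // => l _; rewrite fk mul0r lterm0.
Qed.

Lemma lmulC : commutative lmul.
Proof.
move=> f g; rewrite /lmul exchange_big /=.
by apply: eq_bigr => l _; apply: eq_bigr => k _; rewrite mulrC addrC.
Qed.

Lemma lmul0g : left_zero 0 lmul.
Proof. by move=> g; rewrite /lmul msupp0 big_seq_fset0. Qed.

Lemma lmulDl : left_distributive lmul +%R.
Proof.
move=> f1 f2 g.
rewrite (lmulEw (msuppD_le f1 f2) (fsubset_refl _)).
rewrite (lmulEw (fsubsetUl (msupp f1) (msupp f2)) (fsubset_refl (msupp g))).
rewrite (lmulEw (fsubsetUr (msupp f1) (msupp f2)) (fsubset_refl (msupp g))).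
rewrite -big_split /=; apply: eq_bigr => k _.
rewrite -big_split /=; apply: eq_bigr => l _.
by rewrite mcoeffD mulrDl ltermD.
Qed.

Lemma lmulUg x k g :
  lmul (lterm x k) g = \sum_(l <- msupp g) lterm (x * g@_l) (k + l).
Proof.
rewrite (lmulEw msuppU_le (fsubset_refl _)) big_seq_fset1.
by apply: eq_bigr => l _; rewrite mcoeffUU.
Qed.

Lemma lmulUU x y k l : lmul (lterm x k) (lterm y l) = lterm (x * y) (k + l).
Proof. by rewrite (lmulEw msuppU_le msuppU_le) !big_seq_fset1 !mcoeffUU. Qed.

Lemma lmul1g : left_id lone lmul.
Proof.
move=> g; rewrite lmulUg [RHS]laurentE.
by apply: eq_bigr => l _; rewrite mul1r add0r.
Qed.

Lemma lmul_suml (I : Type) (r : seq I) (F : I -> laurent K) g :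
  lmul (\sum_(i <- r) F i) g = \sum_(i <- r) lmul (F i) g.
Proof.
exact: (big_morph (lmul^~ g) (fun f1 f2 => lmulDl f1 f2 g) (lmul0g g)).
Qed.

Lemma lmul_sumr (I : Type) (r : seq I) (F : I -> laurent K) f :
  lmul f (\sum_(i <- r) F i) = \sum_(i <- r) lmul f (F i).
Proof. by rewrite lmulC lmul_suml; apply: eq_bigr => i _; rewrite lmulC. Qed.

Lemma lmulA : associative lmul.
Proof.
move=> f g h; rewrite [f]laurentE !lmul_suml; apply: eq_bigr => k _.
rewrite [g]laurentE lmul_suml !lmul_sumr lmul_suml; apply: eq_bigr => l _.
rewrite [h]laurentE !lmul_sumr; apply: eq_bigr => m _.
by rewrite !lmulUU mulrA addrA.
Qed.

Lemma lone_neq0 : lone != 0.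
Proof.
apply/eqP => /(congr1 (mcoeff (0 : (int * int)%type))) /eqP.
by rewrite mcoeffUU mcoeff0 oner_eq0.
Qed.

HB.instance Definition _ := GRing.Zmodule_isComNzRing.Build (laurent K)
  lmulA lmulC lmul1g lmulDl lone_neq0.

(* Inverses, chosen classically, so that [f ^ n] makes sense for [n : int]. *)
Definition lunit : {pred laurent K} := fun f => `[< exists g, g * f = 1 >].

Definition linv f : laurent K :=
  if pselect (exists g, g * f = 1) is left e then xchoose (P := fun g => g * f == 1)
    (let: ex_intro g gf := e in ex_intro _ g (introT eqP gf)) else f.

Lemma linvP : {in lunit, left_inverse 1 linv *%R}.
Proof.
move=> f /asboolP fU; rewrite /linv; case: pselect => [e|//].
by apply/eqP; apply: (xchooseP (P := fun g => g * f == 1)).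
Qed.

Lemma lunitPl f g : g * f = 1 -> lunit f.
Proof. by move=> gf; apply/asboolP; exists g. Qed.

Lemma linv_out : {in [predC lunit], linv =1 id}.
Proof.
move=> f; rewrite inE /= => /negP fU; rewrite /linv; case: pselect => // e.
by case: fU; apply/asboolP.
Qed.

HB.instance Definition _ := GRing.ComNzRing_hasMulInverse.Build (laurent K)
  linvP lunitPl linv_out.

Definition laurentU : laurent K := lterm 1 (1, 0).
Definition laurentV : laurent K := lterm 1 (0, 1).

Lemma ltermM x y k l : lterm x k * lterm y l = lterm (x * y) (k + l).
Proof. exact: lmulUU. Qed.

Lemma lterm_unit k : lterm 1 k \is a GRing.unit.
Proof. by apply: (@lunitPl _ (lterm 1 (- k))); rewrite ltermM mulr1 addNr. Qed.

Lemma ltermV k : (lterm 1 k)^-1 = lterm 1 (- k).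
Proof.
apply: (mulrI (lterm_unit k)).
by rewrite divrr ?lterm_unit // ltermM mulr1 addrN.
Qed.

Lemma ltermX k (n : int) : lterm 1 k ^ n = lterm 1 (k *~ n).
Proof.
have nat_case (m : nat) : lterm 1 k ^+ m = lterm 1 (k *+ m).
  elim: m => [|m IHm]; first by rewrite expr0 mulr0n.
  by rewrite exprS IHm ltermM mulr1 mulrS.
case: n => m; first exact: nat_case.
by rewrite NegzE -exprnN nat_case ltermV mulrNz.
Qed.

Lemma laurentUV_exp (m n : int) : laurentU ^ m * laurentV ^ n = lterm 1 (m, n).
Proof.
rewrite !ltermX ltermM mulr1; congr lterm.
have intP (z : int) : (1 : int) *~ z = z by rewrite intz.
have pairMz (x y z : int) : ((x, y) : (int * int)%type) *~ z = (x *~ z, y *~ z).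
  have pairMn (i : nat) : ((x, y) : (int * int)%type) *+ i = (x *+ i, y *+ i).
    by elim: i => [|i IHi] //; rewrite !mulrS IHi.
  by case: z => i; rewrite ?NegzE ?mulrNz /= -?pmulrn pairMn.
by rewrite !pairMz !mul0rz !intP -[LHS]/(m + 0, 0 + n) addr0 add0r.
Qed.

End LaurentRing.

Arguments laurentU {K}.
Arguments laurentV {K}.

(* [u] and [v] are meant to be units of [A]; the index [i] stands for
   k - ceil s. *)
Definition rademacher_carlitz (R : realType) (A : unitRingType)
    (u v : A) (s t : R) (a b : nat) : A :=
  \sum_(i < b) let k : int := Num.ceil s + i%:Z in
    u ^ Num.floor ((k%:~R * a%:R + t) / b%:R) * v ^ k.

(* Main.v *)
Require Import Defs.
From HB Require Import structures.
From mathcomp Require Import all_boot all_order all_algebra.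
From mathcomp Require Import reals.
From mathcomp Require Import ring lra zify.

Set Implicit Arguments.
Unset Strict Implicit.
Unset Printing Implicit Defensive.

Import Order.TTheory GRing.Theory Num.Theory.

Local Open Scope ring_scope.

(** Let L be the line of slope a/b through (p, q), that is
    a x - b y = a p - b q, and write y = f(x), or x = g(y), along it.  Over
    one period the two Rademacher--Carlitz polynomials describe the lattice
    staircase that follows L just above it: with P = ceil p and Q = ceil q,
    it leads from (P, Q) to (P + b, Q + a).

    The term v (1 - u) u^k v^(floor f(k)) is the difference of the end points
    of the horizontal step of the staircase above [k, k+1], at height
    floor f(k) + 1.  The vertical step from level l to l + 1 lies at abscissa
    ceil g(l), since floor f(k) < l and k < ceil g(l) both say that (k, l) is
    strictly above L.  Thus the steps telescope to
    u^P v^Q (1 - u^b v^a), provided the vertical steps use ceil g(l).  The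
    second polynomial, multiplied by u (1 - v), has floor g(l) + 1 instead.
    The two differ exactly when g(l) is an integer, i.e. at a lattice point
    (c, d) of L, where u^(c+1) = u^c - u^c (1 - u) in place of u^c changes the
    sum by - u^c v^d (1 - u) (1 - v).  This is
    [rademacher_carlitz_reciprocity], valid for two units of any commutative
    ring.

    It remains to count the lattice points of L with p <= x < p + b.  There is
    none if a p - b q is not an integer ([lattice_point_sum_eq0]).  If it is
    an integer m, the abscissas are the solutions of a x = m modulo b in a
    window of length b, and coprimality leaves exactly one
    ([lattice_point_sum_monomial]).

    The telescoping along the staircase is [staircase_sum].  It is obtained by
    double counting rather than by walking along the path: each row or column
    power is completed to the boundary of the b by a box by a geometric sum,
    and the cells above the staircase appear once from the rows and once, with
    the opposite sign, from the columns. *)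

Lemma geometric_sum (A : comNzRingType) (x : A) (m n : nat) :
  (m <= n)%N -> (1 - x) * \sum_(m <= k < n) x ^+ k = x ^+ m - x ^+ n.
Proof.
move=> le_mn; rewrite mulr_sumr.
rewrite (@telescope_sumr_eq _ m n (fun k => - x ^+ k)) //; first by ring.
by move=> k _; rewrite exprS; ring.
Qed.

(** The Galois condition makes [h] (heights of the columns) and [w] (abscissas
    at which the rows begin to lie under the staircase) two descriptions of one
    staircase in the box.  Multiplied by (1 - u) (1 - v), the generating
    function [cells] of the cells above it is produced by both sums with
    opposite signs, and only the boundary of the box remains. *)
Lemma staircase_sum (A : comNzRingType) (u v : A) (a b : nat)
    (h w : nat -> nat) :
    (forall i, (i < b)%N -> (h i <= a)%N) ->
    (forall j, (j < a)%N -> (w j <= b)%N) ->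
    (forall i j, (i < b)%N -> (j < a)%N -> (h i <= j)%N = (i < w j)%N) ->
  (1 - u) * (\sum_(i < b) u ^+ i * v ^+ h i)
    + (1 - v) * (\sum_(j < a) u ^+ w j * v ^+ j) = 1 - u ^+ b * v ^+ a.
Proof.
move=> h_le w_le galois.
pose cells := \sum_(i < b) \sum_(j < a | (h i <= j)%N) u ^+ i * v ^+ j.
have row_sum : \sum_(i < b) u ^+ i * v ^+ h i
    = (\sum_(i < b) u ^+ i) * v ^+ a + (1 - v) * cells.
  rewrite mulr_suml mulr_sumr -big_split /=; apply: eq_bigr => i _.
  rewrite -mulr_sumr -(big_geq_mkord (h i) a predT (fun j => v ^+ j)).
  by rewrite mulrCA geometric_sum ?h_le //; ring.
have col_sum : \sum_(j < a) u ^+ w j * v ^+ j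
    = \sum_(j < a) v ^+ j - (1 - u) * cells.
  rewrite /cells (exchange_big_dep predT) //= mulr_sumr -sumrB.
  apply: eq_bigr => j _; rewrite -mulr_suml.
  rewrite (eq_bigl (fun i : 'I_b => (i < w j)%N)); last by move=> i; exact: galois.
  rewrite -(big_ord_widen _ (fun i => u ^+ i)) ?w_le //.
  by rewrite -(big_mkord predT) mulrA geometric_sum // expr0; ring.
have geo x n : (1 - x) * (\sum_(i < n) x ^+ i) = 1 - x ^+ n :> A.
  by rewrite -(big_mkord predT) geometric_sum.
rewrite row_sum col_sum.
transitivity ((1 - u) * (\sum_(i < b) u ^+ i) * v ^+ a
  + (1 - v) * (\sum_(j < a) v ^+ j)); first by ring.
by rewrite !geo; ring.
Qed.

(** Translates between real windows, in which the line is handled, and integer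
    windows starting at a ceiling, over which the sums run. *)
Lemma ceil_window (R : realType) (p : R) (b : nat) (x : int) :
  (Num.ceil p <= x < Num.ceil p + b%:Z) = (p <= x%:~R < p + b%:R).
Proof.
by rewrite -ltrBlDr ceil_le_int ceil_gt_int intrB ltrBlDr.
Qed.

(** The line of slope a / b through (p, q) maps a period in abscissa onto a
    period in ordinate.  With the roles of (a, p) and (b, q) exchanged, this
    also covers the inverse function. *)
Lemma line_window (R : realType) (a b : nat) (p q x : R) :
    (0 < a)%N -> (0 < b)%N -> p <= x < p + b%:R ->
  q <= (x * a%:R + (b%:R * q - a%:R * p)) / b%:R < q + a%:R.
Proof.
rewrite -!(ltr0n R) => a_gt0 b_gt0 /andP[px xp].
by rewrite ler_pdivlMr // ltr_pdivrMr //; apply/andP; split; nra.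
Qed.

(** The lattice points of the line a x - b y = a p - b q are indexed by their
    ordinates, with abscissa g y, because they are compared term by term with
    the Rademacher--Carlitz polynomial that sums over ordinates. *)
Definition lattice_point_sum (R : realType) (A : unitRingType) (u v : A)
    (a b : nat) (p q : R) : A :=
  let g (l : int) : R := (l%:~R * b%:R + (a%:R * p - b%:R * q)) / a%:R in
  \sum_(j < a | g (Num.ceil q + j%:Z) \is a Num.int)
    u ^ Num.floor (g (Num.ceil q + j%:Z)) * v ^ (Num.ceil q + j%:Z).

Section Reciprocity.
Variables (R : realType) (a b : nat) (p q : R).
Hypotheses (a_gt0 : (0 < a)%N) (b_gt0 : (0 < b)%N).

Let f (k : int) : R := (k%:~R * a%:R + (b%:R * q - a%:R * p)) / b%:R.
Let g (l : int) : R := (l%:~R * b%:R + (a%:R * p - b%:R * q)) / a%:R.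
Let P : int := Num.ceil p.
Let Q : int := Num.ceil q.

Let f_window (i : nat) : (i < b)%N ->
  Q <= Num.floor (f (P + i%:Z)) + 1 <= Q + a%:Z.
Proof.
move=> lt_ib.
have /(line_window q a_gt0 b_gt0) : p <= (P + i%:Z)%:~R < p + b%:R.
  by rewrite -ceil_window -/P; lia.
rewrite -/(f _) => /andP[qf fq]; apply/andP; split.
  by rewrite ceil_le_int (le_trans qf) // ltW // floorD1_gt.
rewrite lezD1 floor_lt_int (lt_le_trans fq) // intrD lerD2r.
exact: ceil_ge.
Qed.

Let g_window (j : nat) : (j < a)%N ->
  p <= g (Q + j%:Z) < p + b%:R.
Proof.
move=> lt_ja; apply: line_window => //.
by rewrite -ceil_window -/Q; lia.
Qed.

(* Both sides say that (k, l) is strictly above the line. *)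
Let fg_galois (k l : int) : (Num.floor (f k) < l) = (k < Num.ceil (g l)).
Proof.
have ra_gt0 : 0 < a%:R :> R by rewrite ltr0n.
have rb_gt0 : 0 < b%:R :> R by rewrite ltr0n.
rewrite floor_lt_int ceil_gt_int ltr_pdivrMr // ltr_pdivlMr //.
by apply/idP/idP => ?; lra.
Qed.

(** This is [staircase_sum] for the staircase just above the line, translated
    by (ceil p, ceil q).  The lattice point sum is the price of reading the
    vertical steps at abscissa floor (g l) + 1 instead of ceil (g l). *)
Lemma rademacher_carlitz_reciprocity (A : comUnitRingType) (u v : A) :
    u \is a GRing.unit -> v \is a GRing.unit ->
  v * (1 - u) * rademacher_carlitz v u p (b%:R * q - a%:R * p) a b
    + u * (1 - v) * rademacher_carlitz u v q (a%:R * p - b%:R * q) b a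
  = u ^ P * v ^ Q * (1 - u ^+ b * v ^+ a)
    - lattice_point_sum u v a b p q * (1 - u) * (1 - v).
Proof.
move=> uU vU.
(* The staircase, moved to the origin by (P, Q): [h] gives the height of its
   horizontal steps, [w] the abscissa of its vertical ones. *)
pose h (i : nat) := absz (Num.floor (f (P + i%:Z)) + 1 - Q)%R.
pose w (j : nat) := absz (Num.ceil (g (Q + j%:Z)) - P)%R.
have hE i : (i < b)%N -> Num.floor (f (P + i%:Z)) + 1 = Q + (h i)%:Z.
  by move=> /f_window; rewrite /h; lia.
have wE j : (j < a)%N -> Num.ceil (g (Q + j%:Z)) = P + (w j)%:Z /\ (w j <= b)%N.
  move=> /g_window/andP[pg gp].
  have := le_ceil pg; have := le_ceil (ltW gp).
  rewrite ceilDrz ?natr_int // (intrKceil b) -/P /w; lia.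
have horizontal : v * rademacher_carlitz v u p (b%:R * q - a%:R * p) a b
    = u ^ P * v ^ Q * \sum_(i < b) u ^+ i * v ^+ h i.
  rewrite /rademacher_carlitz !mulr_sumr; apply: eq_bigr => i _ /=.
  rewrite -/P -/(f _) mulrA -{1}(expr1z v) -exprzDr // addrC hE //.
  by rewrite !exprzDr // -!exprnP; ring.
have vertical : u * rademacher_carlitz u v q (a%:R * p - b%:R * q) b a
    = u ^ P * v ^ Q * (\sum_(j < a) u ^+ w j * v ^+ j)
      - (1 - u) * lattice_point_sum u v a b p q.
  rewrite /lattice_point_sum /rademacher_carlitz !mulr_sumr.
  rewrite [X in _ = _ - X]big_mkcond -sumrB.
  apply: eq_bigr => j _ /=; rewrite -/Q -/(g _).
  have [+ _] := wE j (ltn_ord j); rewrite ceil_floor.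
  (* At an integer g value, floor and ceiling agree, so that
     u * u ^ floor = u ^ ceil - (1 - u) u ^ floor; elsewhere floor + 1 is the
     ceiling. *)
  case: ifP => _ /=; rewrite ?addr0 ?subr0 => Fg.
    by rewrite Fg !exprzDr // -!exprnP; ring.
  rewrite mulrA -{1}(expr1z u) -exprzDr // addrC Fg.
  by rewrite !exprzDr // -!exprnP; ring.
have staircase : (1 - u) * (\sum_(i < b) u ^+ i * v ^+ h i)
    + (1 - v) * (\sum_(j < a) u ^+ w j * v ^+ j) = 1 - u ^+ b * v ^+ a.
  apply: staircase_sum => [i /[dup] /hE + /f_window|j /wE[]//|i j ib ja].
    by lia.
  have := fg_galois (P + i%:Z) (Q + j%:Z); have [-> _] := wE _ ja.
  by have := hE _ ib; lia.
rewrite -staircase mulrAC horizontal [u * (1 - v) * _]mulrAC vertical.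
by ring.
Qed.

End Reciprocity.

(** The solutions of the congruence form one class modulo b, and the window
    p <= x < p + b is the set of ceil p + r with 0 <= r < b, so the solution
    is obtained by reducing any other one, shifted by ceil p. *)
Lemma unique_congruence (R : realType) (a b : nat) (m : int) (p : R) :
    (0 < b)%N -> coprime a b ->
  exists c : int, unique (fun x : int => (a%:Z * x = m %[mod b%:Z])%Z
                                         /\ p <= x%:~R < p + b%:R) c.
Proof.
move=> b_gt0 co_ab; have b_neq0 : b%:Z != 0 by lia.
have [[r s] /= rs] := coprimezP a b co_ab.
(* The Bezout relation r a + s b = 1 makes m r a solution. *)
pose P := Num.ceil p; pose c : int := P + ((m * r - P) %% b)%Z.
have acm : (a%:Z * c = m %[mod b])%Z.
  apply/eqP; rewrite eqz_mod_dvd.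
  apply/dvdzP; exists (- (m * s) - a%:Z * ((m * r - P) %/ b)%Z).
  have := divz_eq (m * r - P) b; rewrite /c => E.
  have -> : ((m * r - P) %% b)%Z = m * r - P - ((m * r - P) %/ b)%Z * b by lia.
  by rewrite -[X in _ - X = _]mulr1 -rs; ring.
have c_win : p <= c%:~R < p + b%:R.
  rewrite -ceil_window -/P /c lerDl ltrD2l modz_ge0 //.
  by rewrite ltz_pmod.
exists c; split=> // x [/eqP axm]; rewrite -ceil_window -/P => x_win.
move: c_win; rewrite -ceil_window -/P => c_win.
have : (b %| x - c)%Z.
  rewrite -(@Gauss_dvdzr _ a%:Z) ?mulrBr -?eqz_mod_dvd ?acm //.
  by rewrite /coprimez gcdzC.
move=> /dvdzP[n En].
have n0 : n = 0 by nia.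
by lia.
Qed.

Lemma line_lattice_point (R : realType) (a b : nat) (p q : R) (x l : int) :
    (0 < a)%N ->
  (x%:~R == (l%:~R * b%:R + (a%:R * p - b%:R * q)) / a%:R)
    = (a%:R * x%:~R - b%:R * l%:~R == a%:R * p - b%:R * q).
Proof.
move=> a_gt0; have a_neq0 : a%:R != 0 :> R by rewrite pnatr_eq0; lia.
rewrite -(inj_eq (mulIf a_neq0)) divfK //; apply/eqP/eqP => ?; lra.
Qed.

(** A lattice point (x, y) on the line would exhibit a p - b q as the integer
    a x - b y. *)
Lemma lattice_point_sum_eq0 (R : realType) (A : unitRingType) (u v : A)
    (a b : nat) (p q : R) :
    (0 < a)%N -> a%:R * p - b%:R * q \isn't a Num.int ->
  lattice_point_sum u v a b p q = 0.
Proof.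
move=> a_gt0 e_nint; apply: big_pred0 => j.
apply: contraNF e_nint => /intrP[x /esym/eqP].
rewrite line_lattice_point // => /eqP <-.
by rewrite rpredB ?rpredM ?natr_int ?intr_int.
Qed.

(** A lattice point (x, l) of the line with l in its window has x in the
    corresponding window and satisfies a x = m + b l, so x is the unique
    solution c of the congruence, and l is then determined by x. *)
Lemma lattice_point_sum_monomial (R : realType) (A : unitRingType) (u v : A)
    (a b : nat) (p q : R) (m : int) :
    (0 < a)%N -> (0 < b)%N -> coprime a b -> a%:R * p - b%:R * q = m%:~R ->
  exists c d : int,
    [/\ unique (fun x : int => (a%:Z * x = m %[mod b%:Z])%Z
                               /\ p <= x%:~R < p + b%:R) c,
        d%:~R = (a%:R * c%:~R + b%:R * q - a%:R * p) / b%:R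
      & lattice_point_sum u v a b p q = u ^ c * v ^ d].
Proof.
move=> a_gt0 b_gt0 co_ab em.
pose g (l : int) : R := (l%:~R * b%:R + (a%:R * p - b%:R * q)) / a%:R.
have gE x l : (x%:~R == g l) = (a%:R * x%:~R - b%:R * l%:~R == m%:~R :> R).
  by rewrite line_lattice_point // em.
have [c c_uniq] := unique_congruence m p b_gt0 co_ab.
have [[acm c_win] c_only] := c_uniq.
have /dvdzP[d Ed] : (b %| a%:Z * c - m)%Z by rewrite -eqz_mod_dvd acm.
have dE : a%:R * c%:~R - b%:R * d%:~R = m%:~R :> R.
  have := congr1 (fun z : int => z%:~R : R) Ed; rewrite /= intrB !intrM.
  by move=> E; lra.
have b_neq0 : b%:R != 0 :> R by rewrite pnatr_eq0; lia.
have d_line : d%:~R = (a%:R * c%:~R + b%:R * q - a%:R * p) / b%:R.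
  by apply: (mulIf b_neq0); rewrite divfK //; lra.
exists c, d; split=> //; rewrite /lattice_point_sum.
have d_win : Num.ceil q <= d < Num.ceil q + a%:Z.
  rewrite ceil_window d_line [a%:R * _]mulrC -addrA.
  exact: line_window c_win.
have [j0 dj0] : exists j0 : 'I_a, d = Num.ceil q + (j0 : nat)%:Z.
  have lt_ja : (`|d - Num.ceil q| < a)%N by lia.
  by exists (Ordinal lt_ja) => /=; lia.
have gd : g d = c%:~R by apply/esym/eqP; rewrite gE dE.
rewrite (big_pred1 j0) => [|j]; first by rewrite -dj0 -/(g d) gd (intrKfloor c).
rewrite -/(g _); apply/idP/eqP => [/intrP[x gx]|->]; last first.
  by rewrite -dj0 gd intr_int.
set l := _ + _ in gx.
have lE : a%:R * x%:~R - b%:R * l%:~R = m%:~R :> R by apply/eqP; rewrite -gE gx.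
have cx : c = x.
  apply: c_only; split.
    apply/eqP; rewrite eqz_mod_dvd; apply/dvdzP; exists l.
    apply: (@intr_inj R); rewrite intrB !intrM; lra.
  rewrite -gx; apply: line_window => //.
  by rewrite -ceil_window /l; have := ltn_ord j; lia.
have : d = l.
  by apply: (@intr_inj R); apply: (mulfI b_neq0); move: lE dE; rewrite -cx; lra.
by rewrite dj0 /l => /addrI[] /ord_inj.
Qed.

Theorem corollary2 (R : realType) (K : comNzRingType) (a b : nat)
    (a_gt0 : (0 < a)%N) (b_gt0 : (0 < b)%N) (co_ab : coprime a b) (p q : R) :
  let u : laurent K := laurentU in
  let v : laurent K := laurentV in
  let e : R := a%:R * p - b%:R * q in
  let lhs : laurent K :=
    v * (1 - u) * rademacher_carlitz v u p (b%:R * q - a%:R * p) a b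
    + u * (1 - v) * rademacher_carlitz u v q (a%:R * p - b%:R * q) b a in
  let rhs : laurent K :=
    u ^ Num.ceil p * v ^ Num.ceil q * (1 - u ^+ b * v ^+ a) in
  (forall m : int, e = m%:~R ->
     exists c d : int,
       [/\ unique (fun x : int => (a%:Z * x = m %[mod b%:Z])%Z
                                  /\ p <= x%:~R < p + b%:R) c,
           d%:~R = (a%:R * c%:~R + b%:R * q - a%:R * p) / b%:R
         & lhs = rhs - u ^ c * v ^ d * (1 - u) * (1 - v)])
  /\ (e \isn't a Num.int -> lhs = rhs).
Proof.
move=> u v e lhs rhs.
have lhsE : lhs = rhs - lattice_point_sum u v a b p q * (1 - u) * (1 - v).
  by apply: rademacher_carlitz_reciprocity => //; exact: lterm_unit.
split=> [m em | e_nint]; rewrite lhsE.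
  have [c [d [c_uniq dE ->]]] := lattice_point_sum_monomial u v a_gt0 b_gt0 co_ab em.
  exists c, d; exact: And3 c_uniq dE (erefl _).
by rewrite (lattice_point_sum_eq0 u v a_gt0 e_nint) 2!mul0r subr0.
Qed.
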